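(* Let $n\geq 2$ and let $\Gamma$ be a locally $2\mathbf{K}_n$ graph. Then $\Gamma$ is $3$-connected-homogeneous if and only if $\Gamma$ is isomorphic to the line graph $L(\Sigma)$ of a $3$-arc-transitive and locally $3$-transitive graph $\Sigma$.
   Context: All graphs are finite, simple and undirected. For a vertex $v$ of a graph $\Gamma$, $\Gamma(v)$ is the set of neighbours of $v$, and for $B\subseteq V(\Gamma)$, $[B]$ is the subgraph induced by $B$. A graph is regular if all its vertices have the same number of neighbours. $\Gamma$ is locally $2\mathbf{K}_n$ if for every vertex $v$ the induced subgraph $[\Gamma(v)]$ is isomorphic to $2\mathbf{K}_n$, the disjoint union of two copies of the complete graph $\mathbf{K}_n$. $\Gamma$ is $s$-connected-homogeneous ($s$-CH) if every isomorphism between two isomorphic connected induced subgraphs on at most $s$ vertices extends to an automorphism of $\Gamma$. An $s$-arc in a graph is an ordered $(s+1)$-tuple $(v_0,\dots,v_s)$ of vertices such that $v_{i-1}$ is adjacent to $v_i$ for $1\le i\le s$ and $v_{i-1}\neq v_{i+1}$ for $1\le i\le s-1$. A graph $\Sigma$ is $s$-arc-transitive if it is regular and $\mathrm{Aut}(\Sigma)$ is transitive on the set of $s$-arcs of $\Sigma$. A graph $\Sigma$ is locally $3$-transitive if, for $v\in V(\Sigma)$, the vertex stabilizer $\mathrm{Aut}(\Sigma)_v$ acts $3$-transitively on $\Sigma(v)$. The line graph $L(\Sigma)$ has the edges of $\Sigma$ as vertices, two distinct edges being adjacent if they share a vertex. *)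

(* Defs.v *)
From HB Require Import structures.
From mathcomp Require Import all_boot all_fingroup all_solvable.

Set Implicit Arguments.
Unset Strict Implicit.
Unset Printing Implicit Defensive.

Record sgraph := SGraph {
  vertex :> finType;
  adj : rel vertex;
  adj_sym : symmetric adj;
  adj_irrefl : irreflexive adj }.

Definition graph_iso (G H : sgraph) (f : G -> H) : Prop :=
  bijective f /\ forall x y : G, adj (f x) (f y) = adj x y.

Definition isomorphic (G H : sgraph) : Prop :=
  exists f : G -> H, graph_iso f.

(* The graph with no vertices counts as connected. *)
Definition connected_graph (G : sgraph) : Prop :=
  forall x y : G, connect (@adj G) x y.

Definition nbr (G : sgraph) (v : G) : {set G} := [set w | adj v w].

Definition regular (G : sgraph) : Prop :=
  exists k : nat, forall v : G, #|nbr v| = k.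

Section Induced.
Variables (G : sgraph) (B : {set G}).

Definition induced_adj : rel {x : G | x \in B} :=
  fun x y => adj (val x) (val y).

Lemma induced_adj_sym : symmetric induced_adj.
Proof. by move=> x y; apply: adj_sym. Qed.

Lemma induced_adj_irrefl : irreflexive induced_adj.
Proof. by move=> x; apply: adj_irrefl. Qed.

Definition induced : sgraph := SGraph induced_adj_sym induced_adj_irrefl.
End Induced.

Section Complete.
Variable n : nat.

Definition complete_adj : rel 'I_n := fun i j => i != j.

Lemma complete_adj_sym : symmetric complete_adj.
Proof. by move=> i j; rewrite /complete_adj eq_sym. Qed.

Lemma complete_adj_irrefl : irreflexive complete_adj.
Proof. by move=> i; rewrite /complete_adj eqxx. Qed.

Definition complete : sgraph := SGraph complete_adj_sym complete_adj_irrefl.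
End Complete.

Section DisjointUnion.
Variables G H : sgraph.

Definition disjoint_union_adj : rel (G + H) := fun x y =>
  match x, y with
  | inl u, inl v => adj u v
  | inr u, inr v => adj u v
  | _, _ => false
  end.

Lemma disjoint_union_adj_sym : symmetric disjoint_union_adj.
Proof. by move=> [x|x] [y|y] //=; apply: adj_sym. Qed.

Lemma disjoint_union_adj_irrefl : irreflexive disjoint_union_adj.
Proof. by move=> [x|x] /=; apply: adj_irrefl. Qed.

Definition disjoint_union : sgraph :=
  SGraph disjoint_union_adj_sym disjoint_union_adj_irrefl.
End DisjointUnion.

Section LineGraph.
Variable G : sgraph.

Definition edges : {set {set G}} :=
  [set e : {set G} | [exists x, exists y, adj x y && (e == [set x; y])]].

Definition line_adj : rel {e : {set G} | e \in edges} :=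
  fun e1 e2 => (e1 != e2) && (val e1 :&: val e2 != set0).

Lemma line_adj_sym : symmetric line_adj.
Proof. by move=> e1 e2; rewrite /line_adj eq_sym setIC. Qed.

Lemma line_adj_irrefl : irreflexive line_adj.
Proof. by move=> e; rewrite /line_adj eqxx. Qed.

Definition line_graph : sgraph := SGraph line_adj_sym line_adj_irrefl.
End LineGraph.

Section Automorphisms.
Variable G : sgraph.

Definition graph_aut : {set {perm G}} :=
  [set g : {perm G} | [forall x, forall y, adj (g x) (g y) == adj x y]].

Lemma graph_autP (g : {perm G}) :
  reflect (forall x y : G, adj (g x) (g y) = adj x y) (g \in graph_aut).
Proof.
rewrite inE; apply: (iffP forallP) => [gA x y|gA x].
  by have /forallP/(_ y)/eqP := gA x.
by apply/forallP => y; rewrite gA.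
Qed.

Lemma graph_aut_group_set : group_set graph_aut.
Proof.
apply/group_setP; split=> [|g h /graph_autP gA /graph_autP hA].
  by apply/graph_autP => x y; rewrite !perm1.
by apply/graph_autP => x y; rewrite !permM hA gA.
Qed.

Canonical graph_aut_group := Group graph_aut_group_set.
End Automorphisms.

Definition locally_2K (n : nat) (G : sgraph) : Prop :=
  forall v : G,
    isomorphic (induced (nbr v)) (disjoint_union (complete n) (complete n)).

Definition connected_homogeneous (s : nat) (G : sgraph) : Prop :=
  forall (A B : {set G}) (f : induced A -> induced B),
    connected_graph (induced A) -> connected_graph (induced B) ->
    #|A| <= s -> #|B| <= s -> graph_iso f ->
    exists2 g : {perm G}, g \in graph_aut G &
      forall x : induced A, g (val x) = val (f x).

Definition is_arc (G : sgraph) (s : nat) (p : s.+1.-tuple G) : Prop :=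
  (forall i j : 'I_s.+1, j = i.+1 :> nat -> adj (tnth p i) (tnth p j)) /\
  (forall i j : 'I_s.+1, j = i.+2 :> nat -> tnth p i <> tnth p j).

Definition arc_transitive (s : nat) (G : sgraph) : Prop :=
  regular G /\
  forall p q : s.+1.-tuple G, is_arc p -> is_arc q ->
    exists2 g : {perm G}, g \in graph_aut G &
      forall i, g (tnth p i) = tnth q i.

(* [transitive^3 _, on S | _] requires at least three points in S, so a graph
   with a vertex of valency less than 3 is not locally 3-transitive. *)
Definition locally_3_transitive (G : sgraph) : Prop :=
  forall v : G, [transitive^3 'C_(graph_aut G)[v | 'P], on nbr v | 'P].

(* Main.v *)
Require Import Defs.
From mathcomp Require Import all_boot all_fingroup all_solvable.

(** The neighbourhood of a vertex v of a locally 2K_n graph G is a union of two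
    cliques, so v lies in exactly two maximal cliques, an edge lies in exactly
    one, and two maximal cliques share at most one vertex.  Hence G is the line
    graph of the graph whose vertices are its maximal cliques, adjacent when
    they meet: a vertex of G is the edge joining the two maximal cliques that
    contain it ([clique_graph_labelling]).

    As n >= 2, every edge of G lies in a triangle.  So every vertex and every
    edge extends to a triangle, and G is 3-connected-homogeneous exactly when
    Aut G is transitive on the 2-arcs (a, b, c) with a and c adjacent and on
    those with a and c not adjacent ([connected_homogeneous3_arc2] and
    [arc2_connected_homogeneous3]).  If G = L(S) and S has no triangle, these
    two kinds of 2-arcs are, in S, three distinct edges at a common vertex and
    the edge sequences of 3-arcs ([arc2_ends]).  Transitivity on the second
    kind is 3-arc-transitivity of S.  Transitivity on the first kind is
    vertex-transitivity of S together with local 3-transitivity.  It remains to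
    see that automorphisms pass between S and G: an automorphism of S permutes
    the edges of S, and one of G permutes the maximal cliques of G.

    A root graph S of valency at least 3 is triangle-free because of the local
    structure of G: given a triangle of S and a third edge d at one of its
    vertices v, the two sides of the triangle at v are adjacent vertices of G
    with the common neighbours d and the opposite side, and these would have to
    be adjacent in G ([triangle_free]).  For the clique graph the same fact shows up as the
    non-adjacency in [clique_arc3_arc2]. *)

Set Implicit Arguments.
Unset Strict Implicit.
Unset Printing Implicit Defensive.

Local Open Scope group_scope.

(** * Closed adjacency *)

Section ClosedAdjacency.
Variable G : sgraph.

Definition cadj (x y : G) : bool := (x == y) || adj x y.

Lemma cadj_refl (x : G) : cadj x x.
Proof. by rewrite /cadj eqxx. Qed.

Lemma cadj_sym : symmetric cadj.
Proof. by move=> x y; rewrite /cadj eq_sym adj_sym. Qed.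

Lemma adjW (x y : G) : adj x y -> cadj x y.
Proof. by rewrite /cadj orbC => ->. Qed.

Lemma adj_cadj (x y : G) : adj x y = (x != y) && cadj x y.
Proof. by rewrite /cadj; case: eqP => //= ->; rewrite adj_irrefl. Qed.

Lemma adj_neq (x y : G) : adj x y -> x != y.
Proof. by rewrite adj_cadj => /andP[]. Qed.

Lemma cadj_aut (g : {perm G}) (x y : G) :
  g \in graph_aut G -> cadj (g x) (g y) = cadj x y.
Proof. by move=> /graph_autP gA; rewrite /cadj gA (inj_eq perm_inj). Qed.

Lemma card_nbr_aut (g : {perm G}) (x : G) :
  g \in graph_aut G -> #|nbr (g x)| = #|nbr x|.
Proof.
move=> /graph_autP gA.
have -> : nbr (g x) = g @: nbr x.
  by apply/setP=> y; rewrite -[y](permKV g) (mem_imset _ _ perm_inj) !inE gA.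
by rewrite card_imset //; apply: perm_inj.
Qed.

End ClosedAdjacency.

(** * Homogeneity in terms of 2-arcs *)

(** A 2-arc; whether a and c are adjacent is left open, so that it spans a
    triangle or an induced path. *)
Definition arc2 (G : sgraph) (a b c : G) : bool :=
  [&& adj a b, adj b c & a != c].

Definition arc2_homogeneous (G : sgraph) : Prop :=
  forall a b c a' b' c' : G,
    arc2 a b c -> arc2 a' b' c' -> adj a c = adj a' c' ->
  exists2 g, g \in graph_aut G & [/\ g a = a', g b = b' & g c = c'].

Lemma connected_nbr (G : sgraph) (A : {set G}) (x y : G) :
    connected_graph (induced A) -> x \in A -> y \in A -> x != y ->
  exists2 z, z \in A & adj x z.
Proof.
move=> cA Ax Ay nxy; have /connectP[] := cA (Sub x Ax) (Sub y Ay).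
case=> [_ /(congr1 val)/= eyx|z p /= /andP[xz _] _].
  by rewrite eyx eqxx in nxy.
by exists (val z) => //; apply: valP.
Qed.

(** Each of the three vertices has a neighbour among the other two, so two of
    the three possible edges are present, and they share a vertex. *)
Lemma connected_triple_arc2 (G : sgraph) (A : {set G}) (x y z : G) :
    connected_graph (induced A) -> uniq [:: x; y; z] -> A =i [:: x; y; z] ->
  exists a b c, arc2 a b c /\ A =i [:: a; b; c].
Proof.
move=> cA; rewrite /= !inE negb_or andbT => /andP[/andP[nxy nxz] nyz] AE.
have nbrA u v : u \in A -> v \in A -> u != v ->
    [|| adj u x, adj u y | adj u z].
  move=> Au Av nuv; have [w] := connected_nbr cA Au Av nuv.
  by rewrite AE !inE => /or3P[]/eqP-> ->; rewrite ?orbT.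
have [Ax Ay Az] : [/\ x \in A, y \in A & z \in A].
  by rewrite !AE !inE !eqxx !orbT.
have := nbrA _ _ Ax Ay nxy; have := nbrA _ _ Ay Az nyz.
have := nbrA _ _ Az Ax; rewrite eq_sym => /(_ nxz).
rewrite !adj_irrefl /= orbF (adj_sym z x) (adj_sym z y) (adj_sym y x).
case: (boolP (adj x y)) => [axy|_] /=; last first.
  move=> _ yz xz; exists x, z, y; split=> [|t].
    by rewrite /arc2 xz adj_sym yz.
  by rewrite AE !inE; congr (_ || _); rewrite orbC.
case/orP=> [axz|ayz] _ _; last by exists x, y, z; rewrite /arc2 axy ayz.
exists y, x, z; split=> [|t]; first by rewrite /arc2 adj_sym axy axz.
by rewrite AE !inE orbCA.
Qed.

(** A 2-arc spans a connected subgraph, and the map between two 2-arcs is an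
    isomorphism of the spanned subgraphs as soon as the outer pairs agree in
    adjacency. *)
Lemma connected_homogeneous3_arc2 (G : sgraph) :
  connected_homogeneous 3 G -> arc2_homogeneous G.
Proof.
move=> hG a b c a' b' c' /and3P[ab bc nac] /and3P[ab' bc' nac'] eac.
pose A := [set a; b; c]; pose B := [set a'; b'; c'].
pose f0 x := if x == a then a' else if x == b then b' else c'.
have nba : b != a by rewrite eq_sym adj_neq.
have nca : c != a by rewrite eq_sym.
have ncb : c != b by rewrite eq_sym adj_neq.
have f0a : f0 a = a' by rewrite /f0 eqxx.
have f0b : f0 b = b' by rewrite /f0 eqxx (negPf nba).
have f0c : f0 c = c' by rewrite /f0 (negPf ncb) (negPf nca).
have f0B x : x \in A -> f0 x \in B.
  rewrite /A /B !inE -!orbA => /or3P[]/eqP->;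
    by rewrite ?f0a ?f0b ?f0c eqxx ?orbT.
have f0A : {in A &, forall x y, adj (f0 x) (f0 y) = adj x y}.
  move=> x y; rewrite /A !inE -!orbA.
  by move=> /or3P[]/eqP-> /or3P[]/eqP->; rewrite ?f0a ?f0b ?f0c ?adj_irrefl //;
     rewrite ?ab ?ab' ?bc ?bc' -?eac // 1?adj_sym ?ab ?bc //;
     rewrite 1?[RHS]adj_sym ?ab' ?bc'.
have f0_inj : {in A &, injective f0}.
  have [nac1 nab1 nbc1] : [/\ a' != c', a' != b' & b' != c'].
    by rewrite nac' !adj_neq.
  move=> x y; rewrite !inE -!orbA.
  by move=> /or3P[]/eqP-> /or3P[]/eqP->; rewrite ?f0a ?f0b ?f0c // => /eqP;
     rewrite ?(negPf nac1) ?(negPf nab1) ?(negPf nbc1) // eq_sym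
             ?(negPf nac1) ?(negPf nab1) ?(negPf nbc1).
pose f (u : induced A) : induced B := Sub (f0 (val u)) (f0B _ (valP u)).
have fA (u w : induced A) : adj (f u) (f w) = adj u w.
  exact: f0A (valP u) (valP w).
have f_inj : injective f.
  by move=> u w /(congr1 val) /(f0_inj _ _ (valP u) (valP w)) /val_inj.
have card3 x y z : arc2 x y z -> #|[set x; y; z]| = 3.
  case/and3P=> xy yz nxz; rewrite -setUA cardsU1 cards2 !inE negb_or.
  by rewrite nxz (adj_neq xy) (adj_neq yz).
have conn x y z : arc2 x y z -> connected_graph (induced [set x; y; z]).
  case/and3P=> xy yz nxz.
  have Y : y \in [set x; y; z] by rewrite !inE eqxx orbT.
  have cY u : connect (@adj (induced [set x; y; z])) u (Sub y Y).
    have := valP u; rewrite !inE -orbA => /or3P[]/eqP eu.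
    - by apply: connect1; rewrite /= /induced_adj eu.
    - by apply: eq_connect0; apply: val_inj.
    - by apply: connect1; rewrite /= /induced_adj eu adj_sym.
  move=> u w; apply: connect_trans (cY u) _.
  by rewrite (sym_connect_sym (@adj_sym _)).
have cA : arc2 a b c by apply/and3P.
have cB : arc2 a' b' c' by apply/and3P.
have f_bij : bijective f.
  by apply: inj_card_bij => //; rewrite !card_sig !(card3 _ _ _).
have [] := hG A B f; rewrite ?card3 //; try exact: conn.
move=> g gA gE; exists g => //.
have gf x (Ax : x \in A) : g x = f0 x by apply: (gE (Sub x Ax)).
by rewrite !gf ?f0a ?f0b ?f0c // !inE eqxx ?orbT.
Qed.

(** A nonempty connected subgraph with fewer than three vertices is a vertex or
    an edge.  It and its image are both completed to triangles, which turns the extension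
    problem into one about closed 2-arcs. *)
Lemma arc2_connected_homogeneous3 (G : sgraph) :
    (forall x : G, exists y, adj x y) ->
    (forall x y : G, adj x y -> exists z, adj x z /\ adj y z) ->
  arc2_homogeneous G -> connected_homogeneous 3 G.
Proof.
move=> Gnbr Gtri trG A B f cA _ A3 _ [[f' fK _] fA].
(* The isomorphism f read as a map on all vertices; only its values on A
   matter. *)
pose F x := if insub x is Some u then val (f u) else x.
have FE (u : induced A) : F (val u) = val (f u) by rewrite /F valK.
have Fadj : {in A &, forall x y, adj (F x) (F y) = adj x y}.
  move=> x y Ax Ay; rewrite -[x]/(val (Sub x Ax : induced A)).
  by rewrite -[y]/(val (Sub y Ay : induced A)) !FE; apply: fA.
have Fneq : {in A &, forall x y, (F x != F y) = (x != y)}.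
  move=> x y Ax Ay; rewrite -[x]/(val (Sub x Ax : induced A)).
  by rewrite -[y]/(val (Sub y Ay : induced A)) !FE !(inj_eq val_inj) (can_eq fK).
suff [g gA gF] : exists2 g, g \in graph_aut G & {in A, g =1 F}.
  by exists g => // u; rewrite -FE gF //; apply: valP.
have [A_gt2|] := ltnP 2 #|A|.
  have [x [y [z [[Ax Ay Az] [nxy nyz nzx]]]]] := card_gt2P A_gt2.
  have xyz : uniq [:: x; y; z] by rewrite /= !inE negb_or nxy nyz eq_sym nzx.
  have AE : A =i [:: x; y; z].
    apply/fsym; apply/subset_cardP.
      by rewrite (card_uniqP xyz); apply/eqP; rewrite eqn_leq A_gt2.
    by apply/subsetP=> t; rewrite !inE => /or3P[]/eqP->.
  have [a [b [c [abc {}AE]]]] := connected_triple_arc2 cA xyz AE.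
  have [Aa Ab Ac] : [/\ a \in A, b \in A & c \in A].
    by rewrite !AE !inE !eqxx !orbT.
  have [||g gA [ga gb gc]] := trG a b c (F a) (F b) (F c) abc.
  - by rewrite /arc2 !Fadj // Fneq.
  - by rewrite Fadj.
  by exists g => // t; rewrite AE !inE => /or3P[]/eqP->.
have arc2I (x y z : G) : adj x y -> adj x z -> adj y z -> arc2 x y z.
  by move=> xy xz yz; rewrite /arc2 xy yz adj_neq.
rewrite leq_eqVlt => /orP[/eqP A2|].
  have [x [y [Ax Ay nxy]]] : exists x y, [/\ x \in A, y \in A & x != y].
    by apply/card_gt1P; rewrite A2.
  have AE : A = [set x; y].
    apply/esym/eqP; rewrite eqEcard cards2 nxy A2 andbT.
    by apply/subsetP=> t; rewrite !inE => /orP[]/eqP->.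
  have xy : adj x y.
    have [z] := connected_nbr cA Ax Ay nxy.
    by rewrite AE !inE => /orP[]/eqP->; rewrite ?adj_irrefl.
  have xy' : adj (F x) (F y) by rewrite Fadj.
  have [z [xz yz]] := Gtri _ _ xy; have [z' [xz' yz']] := Gtri _ _ xy'.
  have [|||g gA [gx gy _]] := trG x y z (F x) (F y) z'; rewrite ?arc2I //.
    by rewrite xz xz'.
  by exists g => // t; rewrite AE !inE => /orP[]/eqP->.
rewrite ltnS => /card_le1P A1.
have [A0|[x Ax]] := set_0Vmem A.
  by exists 1 => [|t]; rewrite ?group1 // A0 inE.
have [y xy] := Gnbr x; have [y' xy'] := Gnbr (F x).
have [z [xz yz]] := Gtri _ _ xy; have [z' [xz' yz']] := Gtri _ _ xy'.
have [|||g gA [gx _ _]] := trG x y z (F x) y' z'; rewrite ?arc2I //.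
  by rewrite xz xz'.
by exists g => // t; rewrite (A1 _ Ax) inE => /eqP->.
Qed.

(** * Local 3-transitivity and 3-arc-transitivity by explicit vertices *)

Definition local_triple (G : sgraph) (v x y z : G) : bool :=
  [&& adj v x, adj v y & adj v z] && [&& x != y, x != z & y != z].

(** Transitivity on a set includes that the set is nonempty, hence the
    existence clause. *)
Lemma locally_3_transitiveP (G : sgraph) :
  locally_3_transitive G <->
  forall v : G, (exists x y z, local_triple v x y z) /\
    forall x y z x' y' z',
      local_triple v x y z -> local_triple v x' y' z' ->
    exists2 g, g \in graph_aut G & [/\ g v = v, g x = x', g y = y' & g z = z'].
Proof.
have dtupleE (v x y z : G) :
    ([tuple x; y; z] \in 3.-dtuple(nbr v)) = local_triple v x y z.
  rewrite inE subset_all /= !inE /local_triple negb_or !andbT andbC.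
  by rewrite -!andbA.
split=> [tr3 v | tr3 v].
  have /imsetP[t tD tO] := tr3 v; split.
    case/tupleP: t tD {tO} => x t; case/tupleP: t => y t; case/tupleP: t => z t.
    rewrite (tuple0 t) => tD; exists x, y, z; rewrite -dtupleE.
    by congr (_ \in _): tD; apply: val_inj.
  move=> x y z x' y' z'; rewrite -!dtupleE => D D'.
  have [g] := atransP2 (tr3 v) D D'.
  rewrite inE => /andP[gA /astab1P gv] /(congr1 val) [-> -> ->].
  by exists g.
have [[x [y [z xyz]]] tr] := tr3 v.
have Dxyz : [tuple x; y; z] \in 3.-dtuple(nbr v) by rewrite dtupleE.
have Nv : 'C_(graph_aut G)[v | 'P] \subset 'N(nbr v | 'P).
  apply/subsetP=> g; rewrite inE => /andP[/graph_autP gA /astab1P gv].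
  by apply/astabsP=> u; rewrite !inE /= /aperm -[v in LHS]gv /= /aperm gA.
apply/imsetP; exists [tuple x; y; z] => //; apply/setP=> t; apply/idP/orbitP.
  case/tupleP: t => x' t; case/tupleP: t => y' t; case/tupleP: t => z' t.
  have -> : [tuple of [tuple of x' :: [tuple of y' :: [tuple of z' :: t]]]]
    = [tuple x'; y'; z'] by apply: val_inj; rewrite /= (tuple0 t).
  rewrite dtupleE => xyz'; have [g gA [gv gx gy gz]] := tr _ _ _ _ _ _ xyz xyz'.
  exists g; first by rewrite inE gA; apply/astab1P.
  by apply: val_inj; rewrite /= /aperm gx gy gz.
by case=> g /(subsetP Nv) Ng <-; apply: n_act_dtuple.
Qed.

Definition arc3 (G : sgraph) (x0 x1 x2 x3 : G) : bool :=
  [&& adj x0 x1, adj x1 x2, adj x2 x3, x0 != x2 & x1 != x3].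

Lemma is_arc3P (G : sgraph) (x0 x1 x2 x3 : G) :
  is_arc (s := 3) [tuple x0; x1; x2; x3] <-> arc3 x0 x1 x2 x3.
Proof.
pose o i (lti : i < 4) := Ordinal lti.
split=> [[pA pN] | /and5P[a01 a12 a23 n02 n13]]; last first.
  split=> [[[|[|[|[|i]]]] ?] [[|[|[|[|j]]]] ?]|
           [[|[|[|[|i]]]] ?] [[|[|[|[|j]]]] ?]] //= _;
    by rewrite !(tnth_nth x0) //=; apply/eqP.
apply/and5P; split; [ have := pA (o 0 isT) (o 1%N isT) erefl
                    | have := pA (o 1%N isT) (o 2 isT) erefl
                    | have := pA (o 2 isT) (o 3 isT) erefl
                    | have := pN (o 0 isT) (o 2 isT) erefl
                    | have := pN (o 1%N isT) (o 3 isT) erefl ];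
  by rewrite !(tnth_nth x0) //= => /eqP.
Qed.

Lemma arc_transitive3P (G : sgraph) :
  arc_transitive 3 G <->
  regular G /\ forall x0 x1 x2 x3 y0 y1 y2 y3 : G,
    arc3 x0 x1 x2 x3 -> arc3 y0 y1 y2 y3 ->
    exists2 g, g \in graph_aut G &
      [/\ g x0 = y0, g x1 = y1, g x2 = y2 & g x3 = y3].
Proof.
pose o i (lti : i < 4) := Ordinal lti.
split=> -[regG trG]; split=> //.
  move=> x0 x1 x2 x3 y0 y1 y2 y3 /is_arc3P xA /is_arc3P yA.
  have [g gA gE] := trG _ _ xA yA; exists g => //.
  split; [have := gE (o 0 isT) | have := gE (o 1%N isT)
         | have := gE (o 2 isT) | have := gE (o 3 isT)];
  by rewrite !(tnth_nth x0).
have tupleE (p : 4.-tuple G) : exists x0 x1 x2 x3, p = [tuple x0; x1; x2; x3].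
  case/tupleP: p => x0 p; case/tupleP: p => x1 p; case/tupleP: p => x2 p.
  case/tupleP: p => x3 p; exists x0, x1, x2, x3.
  by apply: val_inj; rewrite /= (tuple0 p).
move=> p q; have [x0 [x1 [x2 [x3 ->]]]] := tupleE p.
have [y0 [y1 [y2 [y3 ->]]]] := tupleE q.
move=> /is_arc3P xA /is_arc3P yA.
have [g gA [g0 g1 g2 g3]] := trG _ _ _ _ _ _ _ _ xA yA.
exists g => // -[[|[|[|[|i]]]] ?] //.
all: by rewrite !(tnth_nth x0).
Qed.

(** * Line graphs as edge labellings *)

Lemma edgesP (G : sgraph) (e : {set G}) :
  reflect (exists x y, adj x y /\ e = [set x; y]) (e \in edges G).
Proof.
rewrite inE; apply: (iffP existsP) => [[x /existsP[y /andP[xy /eqP->]]]|].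
  by exists x, y.
by case=> x [y [xy ->]]; exists x; apply/existsP; exists y; rewrite xy eqxx.
Qed.

(** An isomorphism from G to the line graph of S, as the map sending a vertex of
    G to its pair of end points in S: this avoids the subtype of edges. *)
Definition edge_labelling (G S : sgraph) (ends : G -> {set S}) : Prop :=
  [/\ injective ends,
      forall e, e \in edges S <-> exists x, ends x = e
    & forall x y, adj x y = (x != y) && (ends x :&: ends y != set0)].

Lemma isomorphic_line_graphP (G S : sgraph) :
  isomorphic G (line_graph S) <->
  exists ends : G -> {set S}, edge_labelling ends.
Proof.
split=> [[f [[f' fK f'K] fA]] | [ends [ends_inj endsE endsA]]].
  exists (fun x => val (f x)); split=> [x y /val_inj/(can_inj fK) //|e|x y].
    split=> [Se|[x <-]]; last exact: valP.
    by exists (f' (Sub e Se)); rewrite f'K.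
  by rewrite -fA /= /line_adj (can_eq fK).
have endsP x : ends x \in edges S by apply/endsE; exists x.
pose f x : line_graph S := Sub (ends x) (endsP x).
have f_surj (e : line_graph S) : exists x, f x == e.
  by have /endsE[x xe] := valP e; exists x; apply/eqP/val_inj.
have f_inj : injective f by move=> x y /(congr1 val)/ends_inj.
exists f; split=> [|x y]; last by rewrite endsA /= /line_adj (inj_eq f_inj).
exists (fun e => xchoose (f_surj e)) => [x|e].
  by apply/f_inj/eqP/(xchooseP (f_surj (f x))).
exact/eqP/(xchooseP (f_surj e)).
Qed.

(** * The graph of maximal cliques *)

(** The two cliques are recorded as a 2-colouring c of the neighbours of v.  As
    n >= 2, each colour class contains a vertex other than any prescribed x;
    this one fact yields neighbours, triangles, and a second clique at v. *)
Lemma nbr_two_cliques (n : nat) (G : sgraph) (v : G) :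
    1 < n -> locally_2K n G ->
  exists c : G -> bool,
    {in nbr v &, forall x y, cadj x y = (c x == c y)} /\
    forall (b : bool) (x : G), exists y, [/\ adj v y, y != x & c y = b].
Proof.
move=> n_gt1 /(_ v) [f [[g fK gK] fA]].
pose side (s : 'I_n + 'I_n) := if s is inl _ then true else false.
pose c x := if insub x is Some u then side (f u) else true.
have cE (u : induced (nbr v)) : c (val u) = side (f u) by rewrite /c valK.
have cadjE (u w : induced (nbr v)) :
    cadj (val u) (val w) = (c (val u) == c (val w)).
  rewrite !cE /cadj (inj_eq val_inj) -(can_eq fK).
  rewrite [adj _ _](_ : _ = adj u w) // -fA.
  by case: (f u) (f w) => [i|i] [j|j]; rewrite //= /complete_adj;
     case: (eqVneq i j) => [->|_]; rewrite ?eqxx ?orbT.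
exists c; split=> [x y Nx Ny | b x]; first exact: (cadjE (Sub x Nx) (Sub y Ny)).
(* Of two distinct vertices in the clique of colour b, one differs from x. *)
pose i0 := Ordinal (ltnW n_gt1); pose i1 := Ordinal n_gt1.
pose s (i : 'I_n) : disjoint_union (complete n) (complete n) :=
  if b then inl i else inr i.
have Nb i : adj v (val (g (s i))) by have := valP (g (s i)); rewrite inE.
have cb i : c (val (g (s i))) = b by rewrite cE gK /s; case: b {s Nb}.
case: (eqVneq (val (g (s i0))) x) => [<-|ne]; last by exists (val (g (s i0))).
exists (val (g (s i1))); split=> //.
by rewrite (inj_eq val_inj) (can_eq gK) /s; case: b {s Nb cb}.
Qed.

Section CliqueGraph.
Variable G : sgraph.

(** For an edge xy of a locally 2K_n graph this is the unique maximal clique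
    containing x and y.  The maximal cliques are treated as the lines of a
    partial linear space on the vertices, with two lines through every point. *)
Definition line (x y : G) : {set G} := [set z | cadj x z && cadj y z].

Definition lines : {set {set G}} :=
  [set L | [exists x, exists y, adj x y && (L == line x y)]].

Lemma linesP (L : {set G}) :
  reflect (exists x y, adj x y /\ L = line x y) (L \in lines).
Proof.
rewrite inE; apply: (iffP existsP) => [[x /existsP[y /andP[xy /eqP->]]]|].
  by exists x, y.
by case=> x [y [xy ->]]; exists x; apply/existsP; exists y; rewrite xy eqxx.
Qed.

Definition clique_adj : rel {L : {set G} | L \in lines} :=
  fun L M => (L != M) && (val L :&: val M != set0).

Lemma clique_adj_sym : symmetric clique_adj.
Proof. by move=> L M; rewrite /clique_adj eq_sym setIC. Qed.

Lemma clique_adj_irrefl : irreflexive clique_adj.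
Proof. by move=> L; rewrite /clique_adj eqxx. Qed.

Definition clique_graph : sgraph := SGraph clique_adj_sym clique_adj_irrefl.

Lemma clique_adjP (L M : clique_graph) :
  reflect (L != M /\ exists x, x \in val L /\ x \in val M) (adj L M).
Proof.
apply: (iffP andP) => -[nLM].
  by case/set0Pn=> x /setIP[Lx Mx]; split=> //; exists x.
by case=> x [Lx Mx]; split=> //; apply/set0Pn; exists x; rewrite inE Lx.
Qed.

Lemma clique_adjI (L M : clique_graph) x :
  L != M -> x \in val L -> x \in val M -> adj L M.
Proof. by move=> nLM Lx Mx; apply/clique_adjP; split=> //; exists x. Qed.

Lemma mem_linel (x y : G) : adj x y -> x \in line x y.
Proof. by move=> xy; rewrite inE cadj_refl cadj_sym adjW. Qed.

Lemma lineC (x y : G) : line x y = line y x.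
Proof. by apply/setP=> z; rewrite !inE andbC. Qed.

Lemma mem_liner (x y : G) : adj x y -> y \in line x y.
Proof. by rewrite adj_sym lineC; apply: mem_linel. Qed.

Lemma line_in (x y : G) : adj x y -> line x y \in lines.
Proof. by move=> xy; apply/linesP; exists x, y. Qed.

Lemma line_aut (g : {perm G}) (x y : G) :
  g \in graph_aut G -> g @: line x y = line (g x) (g y).
Proof.
move=> gA; apply/setP=> z; rewrite -[z](permKV g) (mem_imset _ _ perm_inj).
by rewrite !inE !cadj_aut.
Qed.

Lemma clique_graph_aut (g : {perm G}) : g \in graph_aut G ->
  exists2 h, h \in graph_aut clique_graph &
    forall L : clique_graph, val (h L) = g @: val L.
Proof.
move=> gA.
have imP (L : clique_graph) : g @: val L \in lines.
  have /linesP[x [y [xy ->]]] := valP L.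
  by rewrite line_aut // line_in // (graph_autP _ gA).
pose h0 (L : clique_graph) : clique_graph := Sub (g @: val L) (imP L).
have h0_inj : injective h0.
  by move=> L M /(congr1 val)/(imset_inj perm_inj)/val_inj.
exists (perm h0_inj) => [|L]; last by rewrite permE.
apply/graph_autP=> L M; rewrite !permE /= /clique_adj (inj_eq h0_inj) /=.
by rewrite -imsetI ?imset_eq0 // => ? ? _ _; apply: perm_inj.
Qed.

End CliqueGraph.

Section LocallyTwoCliques.
Variables (n : nat) (G : sgraph).
Hypotheses (n_gt1 : 1 < n) (G2K : locally_2K n G).
Implicit Types (v w x y z : G) (L M N : {set G}).

Lemma exists_nbr x : exists y, adj x y.
Proof.
by have [c [_ /(_ true x)[y [xy _ _]]]] := nbr_two_cliques x n_gt1 G2K; exists y.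
Qed.

Lemma exists_triangle x y : adj x y -> exists z, adj x z /\ adj y z.
Proof.
move=> xy; have [c [cE nbrP]] := nbr_two_cliques x n_gt1 G2K.
have [z [xz nzy cz]] := nbrP (c y) y.
by exists z; split=> //; rewrite adj_cadj eq_sym nzy cE ?inE ?cz /=.
Qed.

(** All these vertices are v itself or neighbours of v in the clique of w. *)
Lemma line_clique v w : adj v w -> {in line v w &, forall x y, cadj x y}.
Proof.
move=> vw x y; rewrite !inE => /andP[vx wx] /andP[vy wy].
case: (eqVneq v x) => [<- //|nvx]; case: (eqVneq v y) => [<-|nvy].
  by rewrite cadj_sym.
have [c [cE _]] := nbr_two_cliques v n_gt1 G2K.
have [Nw Nx Ny] : [/\ w \in nbr v, x \in nbr v & y \in nbr v].
  by rewrite !inE vw !adj_cadj nvx nvy.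
by move: wx wy; rewrite !cE // => /eqP<-.
Qed.

Lemma line_uniq L x y : L \in lines G -> x \in L -> y \in L -> x != y ->
  adj x y /\ L = line x y.
Proof.
case/linesP=> v [w [vw ->]] Lx Ly nxy.
have xy : adj x y by rewrite adj_cadj nxy (line_clique vw).
split=> //; apply/setP=> z; apply/idP/idP=> [Lz|].
  by rewrite inE !(line_clique vw).
move=> xyz; rewrite inE !(line_clique xy) // inE.
  by rewrite !(line_clique vw) // mem_liner.
by rewrite !(line_clique vw) // mem_linel.
Qed.

Lemma lines_meet L M x y : L \in lines G -> M \in lines G -> x != y ->
  x \in L -> y \in L -> x \in M -> y \in M -> L = M.
Proof.
move=> GL GM nxy Lx Ly Mx My.
by have [_ ->] := line_uniq GL Lx Ly nxy; have [_ ->] := line_uniq GM Mx My nxy.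
Qed.

Lemma lineP L x : L \in lines G -> x \in L -> exists y, adj x y /\ L = line x y.
Proof.
move=> GL Lx; have /linesP[v [w [vw LE]]] := GL.
have [Lv Lw] : v \in L /\ w \in L by rewrite LE mem_linel ?mem_liner.
have [exv|nxv] := eqVneq x v; last by exists v; apply: line_uniq.
by exists w; apply: line_uniq; rewrite // exv adj_neq.
Qed.

(** Lines through x other than L correspond to the colour class at x that
    avoids L, and a class determines its line. *)
Lemma two_lines L M N x : L \in lines G -> M \in lines G -> N \in lines G ->
  x \in L -> x \in M -> x \in N -> L != M -> L != N -> M = N.
Proof.
move=> GL GM GN Lx Mx Nx.
have [[l [xl ->]] [m [xm ->]]] := (lineP GL Lx, lineP GM Mx).
have [k [xk ->]] := lineP GN Nx.
have [c [cE _]] := nbr_two_cliques x n_gt1 G2K.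
have line_eq y z : adj x y -> adj x z -> c y = c z -> line x y = line x z.
  move=> xy xz eyz; have Lz : z \in line x y.
    by rewrite inE adjW // cE ?inE ?eyz /=.
  by have [] := line_uniq (line_in xy) (mem_linel xy) Lz (adj_neq xz).
have ncl y : adj x y -> line x l != line x y -> c y = ~~ c l.
  move=> xy; have [e|] := eqVneq (c l) (c y).
    by rewrite (line_eq l y) ?eqxx.
  by case: (c y) (c l) => [] [].
by move=> nlm nlk; apply: line_eq; rewrite // (ncl m) ?(ncl k).
Qed.

Lemma other_line L x : L \in lines G -> x \in L ->
  exists M, [/\ M \in lines G, x \in M & L != M].
Proof.
move=> GL Lx; have [l [xl ->]] := lineP GL Lx.
have [c [cE /(_ (~~ c l) l)[m [xm _ cm]]]] := nbr_two_cliques x n_gt1 G2K.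
exists (line x m); split; rewrite ?line_in ?mem_linel //.
apply: contraTneq (mem_liner xm) => <-.
by rewrite inE negb_and (cE l m) ?inE ?cm //; case: (c l); rewrite orbT.
Qed.

Definition cliques_at x : {set clique_graph G} :=
  [set L : clique_graph G | x \in val L].

Lemma in_cliques_at x (L : clique_graph G) : (L \in cliques_at x) = (x \in val L).
Proof. by rewrite inE. Qed.

Lemma cliques_at_pair (L M : clique_graph G) x :
    L != M -> x \in val L -> x \in val M ->
  cliques_at x = [set L; M].
Proof.
move=> nLM Lx Mx; apply/setP=> N; rewrite in_cliques_at !inE.
apply/idP/orP=> [Nx|[]/eqP-> //].
case: (eqVneq N L) => [|nNL]; [by left | right].
apply/eqP/val_inj/esym; apply: (@two_lines (val L) _ _ x) => //; try exact: valP.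
by rewrite eq_sym.
Qed.

Lemma exists_two_cliques x : exists L M : clique_graph G,
  [/\ L != M, x \in val L & x \in val M].
Proof.
have [y xy] := exists_nbr x.
have [M [GM Mx nLM]] := other_line (line_in xy) (mem_linel xy).
exists (Sub (line x y) (line_in xy)), (Sub M GM).
by split=> //=; rewrite mem_linel.
Qed.

(** Injectivity holds because two vertices on the same two lines would be two
    common points of distinct lines. *)
Lemma clique_graph_labelling : edge_labelling cliques_at.
Proof.
split=> [x y exy|e|x y].
- have [L [M [nLM Lx Mx]]] := exists_two_cliques x.
  apply: contraNeq nLM => nxy; apply/eqP/val_inj.
  have Ly (N : clique_graph G) : x \in val N -> y \in val N.
    by rewrite -!in_cliques_at exy.
  by apply: (@lines_meet _ _ x y) => //; try exact: valP; apply: Ly.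
- split=> [/edgesP[L [M [/clique_adjP[nLM [x [Lx Mx]]] ->]]]|[x <-]].
    by exists x; apply: cliques_at_pair.
  have [L [M [nLM Lx Mx]]] := exists_two_cliques x; apply/edgesP; exists L, M.
  by rewrite (clique_adjI nLM Lx Mx) (cliques_at_pair nLM Lx Mx).
apply/idP/andP=> [xy|[nxy /set0Pn[L]]].
  split; first exact: adj_neq.
  apply/set0Pn; exists (Sub (line x y) (line_in xy)).
  by rewrite inE !in_cliques_at /= mem_linel ?mem_liner.
rewrite inE !in_cliques_at => /andP[Lx Ly].
by have [] := line_uniq (valP L) Lx Ly nxy.
Qed.
End LocallyTwoCliques.

(** * Symmetry of the clique graph *)

Section SymmetryOfCliqueGraph.
Variables (n : nat) (G : sgraph).
Hypotheses (n_gt1 : 1 < n) (G2K : locally_2K n G) (trG : arc2_homogeneous G).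
Implicit Types (L M N : clique_graph G) (x y z : G).

Lemma clique_adj_mem L x y : x \in val L -> y \in val L -> x != y -> adj x y.
Proof. by move=> Lx Ly /(line_uniq n_gt1 G2K (valP L) Lx Ly)[]. Qed.

Lemma clique_eq L M x y : x != y ->
  x \in val L -> y \in val L -> x \in val M -> y \in val M -> L = M.
Proof.
move=> nxy Lx Ly Mx My; apply: val_inj.
by apply: (lines_meet n_gt1 G2K (valP L) (valP M) nxy).
Qed.

Lemma two_cliques L M N x : L != M -> L != N ->
  x \in val L -> x \in val M -> x \in val N -> M = N.
Proof.
move=> nLM nLN Lx Mx Nx; apply: val_inj.
by apply: (two_lines n_gt1 G2K (valP L) (valP M) (valP N) Lx Mx Nx).
Qed.

Lemma other_clique L x : x \in val L -> exists M, L != M /\ x \in val M.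
Proof.
move=> Lx; have [M [GM Mx nLM]] := other_line n_gt1 G2K (valP L) Lx.
by exists (Sub M GM).
Qed.

Lemma clique_triangle L : exists x y z,
  [/\ arc2 x y z, adj x z & [/\ x \in val L, y \in val L & z \in val L]].
Proof.
have /linesP[x [y [xy LE]]] := valP L.
have [z [xz yz]] := exists_triangle n_gt1 G2K xy.
exists x, y, z; rewrite /arc2 xy yz adj_neq // LE mem_linel ?mem_liner //.
by rewrite inE !adjW.
Qed.

(** An automorphism of G taking two points of one clique to two points of
    another maps the first clique onto the second.  Each clique contains a
    triangle, so homogeneity supplies such an automorphism and all degrees agree. *)
Lemma clique_graph_regular : regular (clique_graph G).
Proof.
have [L0 _|noL] := pickP (fun L : clique_graph G => true); last first.
  by exists 0 => L; have := noL L.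
exists #|nbr L0| => L.
have [x [y [z [xyz xz [Lx Ly _]]]]] := clique_triangle L0.
have [x' [y' [z' [xyz' xz' [Lx' Ly' _]]]]] := clique_triangle L.
have [|g gA [gx gy _]] := trG xyz xyz'; first by rewrite xz xz'.
have [h hA hE] := clique_graph_aut gA.
have <- : h L0 = L by apply: (@clique_eq _ _ x' y') => //;
  rewrite ?hE -?gx -?gy ?imset_f //; move: xyz';
  case/and3P=> /adj_neq; rewrite gx gy.
by rewrite card_nbr_aut.
Qed.

(** Consecutive cliques of the 3-arc meet in a, b and c.  No point lies in three
    cliques, so a <> b and b <> c.  If a and c were equal or adjacent, c would
    lie on the line ab, which is L1, and hence on the three distinct cliques
    L1, L2 and L3. *)
Lemma clique_arc3_arc2 L0 L1 L2 L3 : arc3 L0 L1 L2 L3 ->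
  exists a b c, [/\ arc2 a b c, ~~ adj a c,
    a \in val L0 /\ a \in val L1, b \in val L1 /\ b \in val L2
  & c \in val L2 /\ c \in val L3].
Proof.
case/and5P=> /clique_adjP[n01 [a [L0a L1a]]] /clique_adjP[n12 [b [L1b L2b]]].
move=> /clique_adjP[n23 [c [L2c L3c]]] n02 n13.
have nab : a != b.
  apply: contraNneq n02 => eab; apply/eqP.
  by apply: (two_cliques _ n12 L1a L0a); rewrite ?eab // eq_sym.
have nbc : b != c.
  apply: contraNneq n13 => ebc; apply/eqP.
  by apply: (two_cliques _ n23 L2b L1b); rewrite ?ebc // eq_sym.
have ab := clique_adj_mem L1a L1b nab; have bc := clique_adj_mem L2b L2c nbc.
have ncac : ~~ cadj a c.
  apply: contraNN n13 => ac; apply/eqP.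
  have [_ L1E] := line_uniq n_gt1 G2K (valP L1) L1a L1b nab.
  have L1c : c \in val L1 by rewrite L1E inE ac adjW.
  by apply: (two_cliques _ n23 L2c L1c L3c); rewrite eq_sym.
exists a, b, c; move: ncac; rewrite /cadj negb_or => /andP[nac nadj].
by rewrite /arc2 ab bc nac.
Qed.

(** The automorphism taking (a, b, c) to (a', b', c') maps the lines ab and bc
    to a'b' and b'c', which are the inner cliques; the outer ones follow, being
    the second lines through a' and c'. *)
Lemma clique_graph_arc_transitive : arc_transitive 3 (clique_graph G).
Proof.
apply/arc_transitive3P; split; first exact: clique_graph_regular.
move=> L0 L1 L2 L3 M0 M1 M2 M3 Larc Marc.
have [a [b [c [abc nac [La0 La1] [Lb1 Lb2] [Lc2 Lc3]]]]] :=
  clique_arc3_arc2 Larc.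
have [a' [b' [c' [abc' nac' [Ma0 Ma1] [Mb1 Mb2] [Mc2 Mc3]]]]] :=
  clique_arc3_arc2 Marc.
have [|g gA [ga gb gc]] := trG abc abc'.
  by rewrite (negPf nac) (negPf nac').
have [h hA hE] := clique_graph_aut gA.
have hL (L : clique_graph G) x x' : g x = x' -> x \in val L -> x' \in val (h L).
  by move=> <- Lx; rewrite hE imset_f.
case/and3P: abc' => /adj_neq nab' /adj_neq nbc' _.
case/and5P: Larc => /adj_neq nL01 _ /adj_neq nL23 _ _.
case/and5P: Marc => /adj_neq nM01 _ /adj_neq nM23 _ _.
have h1 : h L1 = M1.
  by apply: (clique_eq nab') => //; [apply: hL ga _ | apply: hL gb _].
have h2 : h L2 = M2.
  by apply: (clique_eq nbc') => //; [apply: hL gb _ | apply: hL gc _].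
exists h => //; split=> //.
  apply: (two_cliques _ _ Ma1 (hL _ _ _ ga La0) Ma0); last by rewrite eq_sym.
  by rewrite -h1 (inj_eq perm_inj) eq_sym.
apply: (two_cliques _ nM23 Mc2 (hL _ _ _ gc Lc3) Mc3).
by rewrite -h2 (inj_eq perm_inj).
Qed.

(** Neighbours of L correspond to the points of L: each such point lies on
    exactly one further clique. *)
Lemma clique_local_triple L M1 M2 M3 x1 x2 x3 :
    [/\ L != M1, L != M2 & L != M3] ->
    [/\ x1 \in val L, x2 \in val L & x3 \in val L] ->
    [/\ x1 \in val M1, x2 \in val M2 & x3 \in val M3] ->
  local_triple L M1 M2 M3 = [&& x1 != x2, x1 != x3 & x2 != x3].
Proof.
case=> n1 n2 n3 [Lx1 Lx2 Lx3] [Mx1 Mx2 Mx3].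
rewrite /local_triple (clique_adjI n1 Lx1) // (clique_adjI n2 Lx2) //.
rewrite (clique_adjI n3 Lx3) //=.
have neqE M N x y : L != M -> L != N -> x \in val L -> y \in val L ->
    x \in val M -> y \in val N -> (M != N) = (x != y).
  move=> nLM nLN Lx Ly Mx Ny; congr (~~ _); apply/eqP/eqP=> [eMN|exy].
    apply: contraNeq nLM => nxy; apply/eqP.
    by apply: (clique_eq nxy); rewrite // eMN.
  by apply: (two_cliques nLM nLN Lx Mx); rewrite exy.
by rewrite (neqE M1 M2 x1 x2) // (neqE M1 M3 x1 x3) // (neqE M2 M3 x2 x3).
Qed.

(** Three neighbours of L are three points of the clique L, which form a closed
    2-arc.  An automorphism of G taking three points of L to three points of L
    fixes L and moves the other cliques through these points accordingly. *)
Lemma clique_graph_locally_3_transitive : locally_3_transitive (clique_graph G).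
Proof.
apply/locally_3_transitiveP=> L; split.
  have [x [y [z [xyz xz [Lx Ly Lz]]]]] := clique_triangle L.
  have [M1 [n1 M1x]] := other_clique Lx.
  have [M2 [n2 M2y]] := other_clique Ly.
  have [M3 [n3 M3z]] := other_clique Lz.
  exists M1, M2, M3; rewrite (@clique_local_triple _ _ _ _ x y z) //.
  by case/and3P: xyz => /adj_neq-> /adj_neq-> ->.
have points M1 M2 M3 : local_triple L M1 M2 M3 -> exists x1 x2 x3,
    [/\ [&& x1 != x2, x1 != x3 & x2 != x3], [/\ L != M1, L != M2 & L != M3],
        [/\ x1 \in val L, x2 \in val L & x3 \in val L]
      & [/\ x1 \in val M1, x2 \in val M2 & x3 \in val M3]].
  move=> LM; case/andP: (LM) => /and3P[].
  move=> /clique_adjP[n1 [x1 [Lx1 Mx1]]] /clique_adjP[n2 [x2 [Lx2 Mx2]]].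
  move=> /clique_adjP[n3 [x3 [Lx3 Mx3]]] _.
  by exists x1, x2, x3; split=> //; rewrite -(@clique_local_triple L M1 M2 M3).
move=> M1 M2 M3 N1 N2 N3 /points[x1 [x2 [x3 [nx nM xL xM]]]].
move=> /points[y1 [y2 [y3 [ny [nN1 nN2 nN3] [yL1 yL2 yL3] [yN1 yN2 yN3]]]]].
case: nM xL xM => nM1 nM2 nM3 [xL1 xL2 xL3] [xM1 xM2 xM3].
case/and3P: nx => x12 x13 x23; case/and3P: ny => y12 y13 y23.
have arc2L z1 z2 z3 : z1 \in val L -> z2 \in val L -> z3 \in val L ->
    z1 != z2 -> z1 != z3 -> z2 != z3 -> arc2 z1 z2 z3.
  by move=> L1 L2 L3 n12 n13 n23; rewrite /arc2 !(@clique_adj_mem L).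
have [|||g gA [g1 g2 g3]] := @trG x1 x2 x3 y1 y2 y3; rewrite ?arc2L //.
  by rewrite !(@clique_adj_mem L).
have [h hA hE] := clique_graph_aut gA.
have hL (K : clique_graph G) x x' : g x = x' -> x \in val K -> x' \in val (h K).
  by move=> <- Kx; rewrite hE imset_f.
have hLL : h L = L.
  by apply: (clique_eq y12) => //; [apply: hL g1 _ | apply: hL g2 _].
have hM (M N : clique_graph G) x y :
    g x = y -> x \in val M -> y \in val L -> y \in val N ->
    L != M -> L != N -> h M = N.
  move=> gx Mx Ly Ny nLM nLN.
  apply: (two_cliques _ nLN Ly (hL _ _ _ gx Mx) Ny).
  by rewrite -hLL (inj_eq perm_inj).
exists h => //; split=> //.
- exact: hM g1 _ _ _ _ _.
- exact: hM g2 _ _ _ _ _.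
- exact: hM g3 _ _ _ _ _.
Qed.

End SymmetryOfCliqueGraph.

(** * From the root graph to its line graph *)

Section LabelledLineGraph.
Variables (n : nat) (G S : sgraph) (ends : G -> {set S}).
Hypotheses (n_gt1 : 1 < n) (G2K : locally_2K n G).
Hypotheses (labG : edge_labelling ends) (loc3S : locally_3_transitive S).
Implicit Types (a b c : G) (u v w x : S).

Lemma labelling_aut (h : {perm S}) : h \in graph_aut S ->
  exists2 g, g \in graph_aut G & forall a, ends (g a) = h @: ends a.
Proof.
move=> /graph_autP hA; have [ends_inj endsE endsA] := labG.
have imP a : exists b, ends b == h @: ends a.
  have /endsE/edgesP[u [v [uv ->]]] : exists b, ends b = ends a by exists a.
  have [|b bE] := (endsE [set h u; h v]).1; last first.
    by exists b; rewrite bE imsetU1 imset_set1.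
  by apply/edgesP; exists (h u), (h v); rewrite hA.
pose g0 a := xchoose (imP a).
have g0E a : ends (g0 a) = h @: ends a by apply/eqP/(xchooseP (imP a)).
have g0_inj : injective g0.
  by move=> a b /(congr1 ends); rewrite !g0E => /(imset_inj perm_inj)/ends_inj.
exists (perm g0_inj) => [|a]; last by rewrite permE.
apply/graph_autP=> a b; rewrite !permE !endsA (inj_eq g0_inj) !g0E.
by rewrite -imsetI ?imset_eq0 // => ? ? _ _; apply: perm_inj.
Qed.

Lemma ends_at a v : v \in ends a -> exists u, adj u v /\ ends a = [set u; v].
Proof.
have [_ endsE _] := labG.
have /endsE/edgesP[u [w [uw ->]]] : exists b, ends b = ends a by exists a.
rewrite !inE => /orP[]/eqP->; last by exists u.
by exists w; rewrite adj_sym setUC.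
Qed.

Lemma label_exists u v : adj u v -> exists a, ends a = [set u; v].
Proof. by have [_ endsE _] := labG => uv; apply/endsE/edgesP; exists u, v. Qed.

Lemma adj_ends a b : adj a b -> exists u v w,
  [/\ adj u v, adj v w, u != w, ends a = [set u; v] & ends b = [set v; w]].
Proof.
have [ends_inj _ endsA] := labG; rewrite endsA => /andP[nab /set0Pn[v]].
rewrite inE => /andP[/ends_at[u [uv aE]] /ends_at[w [wv bE]]].
exists u, v, w; rewrite uv adj_sym wv aE bE (setUC [set w]); split=> //.
apply: contraNneq nab => euw; apply/eqP/ends_inj.
by rewrite aE bE euw.
Qed.

Lemma adj_labels a b u v w :
  ends a = [set u; v] -> ends b = [set w; v] -> u != w -> v != w -> adj a b.
Proof.
have [ends_inj _ endsA] := labG => aE bE nuw nvw; rewrite endsA.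
apply/andP; split; last by apply/set0Pn; exists v; rewrite aE bE !inE eqxx !orbT.
apply: contraNneq nuw => eab.
have : w \in ends a by rewrite eab bE !inE eqxx.
by rewrite aE !inE !(eq_sym w) (negPf nvw) orbF.
Qed.

Lemma nbr_avoiding v u w : exists x, [/\ adj v x, x != u & x != w].
Proof.
have [[x [y [z /andP[/and3P[vx vy vz] /and3P[nxy nxz nyz]]]]] _] :=
  (locally_3_transitiveP S).1 loc3S v.
case: (boolP ((x != u) && (x != w))) => [/andP[]|]; first by exists x.
case: (boolP ((y != u) && (y != w))) => [/andP[]|]; first by exists y.
case: (boolP ((z != u) && (z != w))) => [/andP[]|]; first by exists z.
rewrite !negb_and !negbK => /orP[]/eqP ez /orP[]/eqP ey /orP[]/eqP ex; subst.
all: by move: nxy nxz nyz; rewrite ?eqxx.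
Qed.

(** Let x be a further neighbour of v.  The edges a = uv and b = vw are adjacent
    vertices of G; c = uw and d = xv are both adjacent to each of them, but c
    and d are disjoint.  In G two common neighbours of adjacent vertices lie
    in the clique through these, so c and d would be equal or adjacent. *)
Lemma triangle_free u v w : adj u v -> adj v w -> adj u w -> False.
Proof.
move=> uv vw uw; have [_ _ endsA] := labG.
have [vu wu] : adj v u /\ adj w u by rewrite !(adj_sym _ u).
have [x [vx nxu nxw]] := nbr_avoiding v u w.
have [a aE] := label_exists uv; have [c cE] := label_exists uw.
have [b bE] := label_exists (etrans (adj_sym w v) vw).
have [d dE] := label_exists (etrans (adj_sym x v) vx).
have ab : adj a b by apply: adj_labels aE bE _ _; rewrite adj_neq.
have ac : adj a c.
  rewrite setUC in aE; rewrite setUC in cE.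
  by apply: adj_labels aE cE _ _; rewrite adj_neq.
have bc : adj b c.
  by rewrite setUC in bE; apply: adj_labels bE cE _ _; rewrite adj_neq.
have ad : adj a d by apply: adj_labels aE dE _ _; [rewrite eq_sym | apply: adj_neq].
have bd : adj b d by apply: adj_labels bE dE _ _; [rewrite eq_sym | apply: adj_neq].
have : cadj c d.
  by apply: (line_clique n_gt1 G2K ab); rewrite inE !adjW.
rewrite /cadj endsA.
have -> : ends c :&: ends d = set0.
  apply/setP=> t; rewrite cE dE !inE; apply/negP.
  by case/andP=> /orP[]/eqP-> /orP[]/eqP e; move: nxu nxw uv vw;
    rewrite e ?eqxx ?adj_irrefl.
rewrite eqxx andbF orbF => /eqP ecd; move: cE; rewrite ecd dE => /setP/(_ v).
by rewrite !inE eqxx orbT !(negPf (adj_neq _)).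
Qed.

(** The edges a and b share v, and c meets b in v or in its other end point w.
    In the second case a common end point of a and c would close a triangle
    u, v, w. *)
Lemma arc2_ends a b c : arc2 a b c ->
  if adj a c then exists v u w x, [/\ local_triple v u w x,
    ends a = [set u; v], ends b = [set w; v] & ends c = [set x; v]]
  else exists u v w x, [/\ arc3 u v w x,
    ends a = [set u; v], ends b = [set v; w] & ends c = [set w; x]].
Proof.
have [ends_inj _ endsA] := labG.
case/and3P=> /adj_ends[u [v [w [uv vw nuw aE bE]]]] bc nac.
have nbc := adj_neq bc; move: bc; rewrite endsA nbc => /set0Pn[t].
rewrite inE => /andP[]; rewrite {1}bE !inE => /orP[]/eqP-> /ends_at[x [xt cE]].
  have nux : u != x.
    by apply: contraNneq nac => eux; apply/eqP/ends_inj; rewrite aE cE eux.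
  have nwx : w != x.
    by apply: contraNneq nbc => ewx; apply/eqP/ends_inj; rewrite bE cE ewx setUC.
  have -> : adj a c by apply: adj_labels aE cE nux _; rewrite eq_sym adj_neq.
  exists v, u, w, x; rewrite bE (setUC [set v]); split=> //.
  by rewrite /local_triple !(adj_sym v) uv xt nuw nux nwx adj_sym vw.
have nvx : v != x.
  by apply: contraNneq nbc => evx; apply/eqP/ends_inj; rewrite bE cE evx.
have -> : adj a c = false.
  rewrite endsA nac /=; apply/negbTE; rewrite negbK; apply/eqP/setP=> s.
  rewrite aE cE !inE; apply/negP=> /andP[/orP[]/eqP-> /orP[]/eqP e].
  - by apply: (triangle_free uv vw); rewrite e.
  - by rewrite e eqxx in nuw.
  - by rewrite e eqxx in nvx.
  - by rewrite e adj_irrefl in vw.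
exists u, v, w, x; rewrite cE (setUC [set x]); split=> //.
by rewrite /arc3 uv vw adj_sym xt nuw nvx.
Qed.

(** Open 2-arcs of G are 3-arcs of S.  For closed ones, 3-arc-transitivity moves
    the common vertex v to v', because every 2-arc u, v, w extends to a 3-arc,
    and local 3-transitivity at v' then aligns the three edges. *)
Lemma labelling_arc2_homogeneous : arc_transitive 3 S -> arc2_homogeneous G.
Proof.
have [ends_inj _ endsA] := labG; case/arc_transitive3P=> _ trS.
have label_eq (g : {perm G}) (h : {perm S}) a b u v u' v' :
    (forall d, ends (g d) = h @: ends d) -> h u = u' -> h v = v' ->
    ends a = [set u; v] -> ends b = [set u'; v'] -> g a = b.
  move=> gE hu hv aE bE; apply: ends_inj.
  by rewrite gE aE bE imsetU1 imset_set1 hu hv.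
move=> a b c a' b' c' abc abc' eac.
have := arc2_ends abc'; have := arc2_ends abc; rewrite -eac.
case: ifP => _; last first.
  move=> [u [v [w [x [uvwx aE bE cE]]]]] [u' [v' [w' [x' [uvwx' aE' bE' cE']]]]].
  have [h /labelling_aut[g gA gE] [hu hv hw hx]] := trS _ _ _ _ _ _ _ _ uvwx uvwx'.
  exists g => //; split.
  - exact: label_eq gE hu hv aE aE'.
  - exact: label_eq gE hv hw bE bE'.
  - exact: label_eq gE hw hx cE cE'.
move=> [v [u [w [x [vuwx aE bE cE]]]]] [v' [u' [w' [x' [vuwx' aE' bE' cE']]]]].
have arc_from (s t y z : S) : local_triple s t y z -> exists q, arc3 t s y q.
  case/andP=> /and3P[st sy sz] /and3P[nty ntz nyz].
  have [q [yq nqs _]] := nbr_avoiding y s s.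
  by exists q; rewrite /arc3 adj_sym st sy yq nty eq_sym nqs.
have [q vq] := arc_from _ _ _ _ vuwx; have [q' vq'] := arc_from _ _ _ _ vuwx'.
have [h1 h1A [_ h1v _ _]] := trS _ _ _ _ _ _ _ _ vq vq'.
have vuwx1 : local_triple v' (h1 u) (h1 w) (h1 x).
  move: vuwx; rewrite /local_triple -h1v !(graph_autP _ h1A).
  by rewrite !(inj_eq perm_inj).
have [_ /(_ _ _ _ _ _ _ vuwx1 vuwx')[h2 h2A [h2v h2u h2w h2x]]] :=
  (locally_3_transitiveP S).1 loc3S v'.
have [g gA gE] := labelling_aut (groupM h1A h2A).
have hv : (h1 * h2) v = v' by rewrite permM h1v.
exists g => //; split.
- by apply: label_eq gE _ hv aE aE'; rewrite permM.
- by apply: label_eq gE _ hv bE bE'; rewrite permM.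
- by apply: label_eq gE _ hv cE cE'; rewrite permM.
Qed.

End LabelledLineGraph.

(** * The characterisation *)

Theorem theorem1p2 (n : nat) (Gamma : sgraph) :
  2 <= n -> locally_2K n Gamma ->
  (connected_homogeneous 3 Gamma <->
   exists Sigma : sgraph,
     [/\ arc_transitive 3 Sigma,
         locally_3_transitive Sigma
       & isomorphic Gamma (line_graph Sigma)]).
Proof.
move=> n_gt1 G2K; split=> [/connected_homogeneous3_arc2 trG | [S [arcS locS]]].
  exists (clique_graph Gamma); split.
  - exact: clique_graph_arc_transitive n_gt1 G2K trG.
  - exact: clique_graph_locally_3_transitive n_gt1 G2K trG.
  apply/isomorphic_line_graphP; exists (@cliques_at Gamma).
  exact: clique_graph_labelling n_gt1 G2K.
case/isomorphic_line_graphP=> ends labG.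
apply: arc2_connected_homogeneous3.
- exact: exists_nbr n_gt1 G2K.
- exact: exists_triangle n_gt1 G2K.
exact: labelling_arc2_homogeneous n_gt1 G2K labG locS arcS.
Qed.
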